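(* Let $A$ carry an IF-structure in a strict symmetric monoidal $\dagger$-category. Let $\alpha:A\to A$ be a green phase and let $k:A\to A$ be a green-classical map. Then $k\circ\alpha\circ k^\dagger$ is a green phase.
   Context: Work in a strict symmetric monoidal $\dagger$-category (unit $I$, symmetry $\sigma$; $u$ unitary means $u^\dagger u=\mathrm{id}$, $uu^\dagger=\mathrm{id}$). A $\dagger$-SCFA on $A$ is $(\mu,\eta,\delta=\mu^\dagger,\epsilon=\eta^\dagger)$ with $(\mu,\eta)$ a commutative monoid, $(\mu\otimes\mathrm{id})(\mathrm{id}\otimes\delta)=\delta\mu=(\mathrm{id}\otimes\mu)(\delta\otimes\mathrm{id})$, and $\mu\delta=\mathrm{id}_A$. An IF-structure on $A$ is a pair of $\dagger$-SCFAs, green $(\mu_g,\eta_g,\delta_g,\epsilon_g)$ and red $(\mu_r,\eta_r,\delta_r,\epsilon_r)$, with $\delta_g\mu_r=(\mu_r\otimes\mu_r)(\mathrm{id}\otimes\sigma\otimes\mathrm{id})(\delta_g\otimes\delta_g)$, $\delta_g\eta_r=\eta_r\otimes\eta_r$, $\epsilon_g\mu_r=\epsilon_g\otimes\epsilon_g$, $\eta_r=(\epsilon_r\otimes\mathrm{id}_A)\delta_g\eta_g$, $\epsilon_g=\epsilon_r\mu_r(\mathrm{id}_A\otimes\eta_g)$; scalar factors built from $\epsilon_g\eta_r$ accompanying the bialgebra laws are suppressed throughout. A green phase is a unitary $\alpha:A\to A$ with $\mu_g\circ(\alpha\otimes\mathrm{id}_A)=\alpha\circ\mu_g$. A point $\psi:I\to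 A$ is green-set-like if $\delta_g\psi=\psi\otimes\psi$. A green-classical map is a map of the form $k=\mu_r\circ(\psi\otimes\mathrm{id}_A)$ where $\psi$ is green-set-like and $k$ is unitary (so $k$ is a red phase). *)

(* Defs.v *)
From Corelib Require Import ssreflect.

Set Implicit Arguments.
Unset Strict Implicit.
Unset Printing Implicit Defensive.

(* Strictness is equality of objects, e.g. (A * B) * C = A * (B * C).  A
   morphism is moved along such an equality by composing it with the identity
   read at the other type; [eq_hom] is that morphism. *)
Definition eq_hom (Ob : Type) (Hom : Ob -> Ob -> Type)
    (id : forall A, Hom A A) (A B : Ob) (e : A = B) : Hom A B :=
  match e in _ = B' return Hom A B' with eq_refl => id A end.

(* [tensmA], [tens1m] and [tensm1] are the strictness equations for morphisms,
   (f * g) * h = f * (g * h), id_I * f = f and f * id_I = f. *)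
Record strict_sym_monoidal_dagger_category := {
  ob : Type;
  hom : ob -> ob -> Type;
  id : forall A, hom A A;
  comp : forall {A B C}, hom B C -> hom A B -> hom A C;
  comp_idl : forall A B (f : hom A B), comp (id B) f = f;
  comp_idr : forall A B (f : hom A B), comp f (id A) = f;
  compA : forall A B C D (h : hom C D) (g : hom B C) (f : hom A B),
    comp h (comp g f) = comp (comp h g) f;

  unit : ob;
  tens : ob -> ob -> ob;
  tensA : forall A B C, tens (tens A B) C = tens A (tens B C);
  tens1o : forall A, tens unit A = A;
  tenso1 : forall A, tens A unit = A;
  tensm : forall {A B A' B'}, hom A A' -> hom B B' ->
    hom (tens A B) (tens A' B');
  tensm_id : forall A B, tensm (id A) (id B) = id (tens A B);
  tensm_comp : forall A B C A' B' C'
      (g : hom B C) (f : hom A B) (g' : hom B' C') (f' : hom A' B'),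
    tensm (comp g f) (comp g' f') = comp (tensm g g') (tensm f f');
  tensmA : forall A B C A' B' C'
      (f : hom A A') (g : hom B B') (h : hom C C'),
    comp (eq_hom id (tensA A' B' C')) (tensm (tensm f g) h)
    = comp (tensm f (tensm g h)) (eq_hom id (tensA A B C));
  tens1m : forall A B (f : hom A B),
    comp (eq_hom id (tens1o B)) (tensm (id unit) f)
    = comp f (eq_hom id (tens1o A));
  tensm1 : forall A B (f : hom A B),
    comp (eq_hom id (tenso1 B)) (tensm f (id unit))
    = comp f (eq_hom id (tenso1 A));

  sym : forall A B, hom (tens A B) (tens B A);
  sym_nat : forall A B A' B' (f : hom A A') (g : hom B B'),
    comp (sym A' B') (tensm f g) = comp (tensm g f) (sym A B);
  symK : forall A B, comp (sym B A) (sym A B) = id (tens A B);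
  sym_hexagon : forall A B C,
    comp (eq_hom id (tensA B C A))
      (comp (sym A (tens B C)) (eq_hom id (tensA A B C)))
    = comp (tensm (id B) (sym A C))
        (comp (eq_hom id (tensA B A C)) (tensm (sym A B) (id C)));
  sym_unit : forall A,
    comp (eq_hom id (tens1o A)) (sym A unit) = eq_hom id (tenso1 A);

  dag : forall {A B}, hom A B -> hom B A;
  dag_id : forall A, dag (id A) = id A;
  dag_comp : forall A B C (g : hom B C) (f : hom A B),
    dag (comp g f) = comp (dag f) (dag g);
  dagK : forall A B (f : hom A B), dag (dag f) = f;
  dag_tensm : forall A B A' B' (f : hom A A') (g : hom B B'),
    dag (tensm f g) = tensm (dag f) (dag g);
  dag_sym : forall A B, dag (sym A B) = sym B A
}.

Arguments hom {_} _ _.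
Arguments id {_} A.
Arguments comp {_ _ _ _} _ _.
Arguments unit {_}.
Arguments tens {_} _ _.
Arguments tensm {_ _ _ _ _} _ _.
Arguments tensA {_} A B C.
Arguments tens1o {_} A.
Arguments tenso1 {_} A.
Arguments sym {_} A B.
Arguments dag {_ _ _} _.

Declare Scope smdc_scope.
Delimit Scope smdc_scope with smdc.
Local Open Scope smdc_scope.

Notation "A ⊠ B" := (tens A B)
  (at level 35, right associativity) : smdc_scope.
Notation "f ⊗ g" := (tensm f g)
  (at level 35, right associativity) : smdc_scope.
Notation "g ∘ f" := (comp g f)
  (at level 40, left associativity) : smdc_scope.
Notation "f '†'" := (dag f) (at level 2, left associativity, format "f '†'")
  : smdc_scope.
Notation "'cast' e" := (eq_hom (@id _) e)
  (at level 10, e at level 9) : smdc_scope.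
Notation "'uncast' e" := (eq_hom (@id _) (eq_sym e))
  (at level 10, e at level 9) : smdc_scope.

Definition unitary (C : strict_sym_monoidal_dagger_category) (A B : ob C)
    (u : hom A B) : Prop :=
  u† ∘ u = id A /\ u ∘ u† = id B.

Definition scale (C : strict_sym_monoidal_dagger_category) (A B : ob C)
    (s : hom (@unit C) unit) (f : hom A B) : hom A B :=
  cast (tens1o B) ∘ (s ⊗ f) ∘ uncast (tens1o A).

Notation "s • f" := (scale s f)
  (at level 41, right associativity) : smdc_scope.

(* id ⊗ sym ⊗ id *)
Definition middle_swap (C : strict_sym_monoidal_dagger_category)
    (A B D E : ob C) : hom ((A ⊠ B) ⊠ (D ⊠ E)) ((A ⊠ D) ⊠ (B ⊠ E)) :=
  uncast (tensA A D (B ⊠ E))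
  ∘ (id A ⊗ (cast (tensA D B E) ∘ (sym B D ⊗ id E) ∘ uncast (tensA B D E)))
  ∘ cast (tensA A B (D ⊠ E)).

Record dagger_SCFA (C : strict_sym_monoidal_dagger_category) (A : ob C) := {
  mu : hom (A ⊠ A) A;
  eta : hom unit A;
  muA : mu ∘ (mu ⊗ id A) = mu ∘ (id A ⊗ mu) ∘ cast (tensA A A A);
  mu_unitl : mu ∘ (eta ⊗ id A) = cast (tens1o A);
  mu_unitr : mu ∘ (id A ⊗ eta) = cast (tenso1 A);
  muC : mu ∘ sym A A = mu;
  frobenius_l :
    (mu ⊗ id A) ∘ uncast (tensA A A A) ∘ (id A ⊗ mu†) = mu† ∘ mu;
  frobenius_r :
    mu† ∘ mu = (id A ⊗ mu) ∘ cast (tensA A A A) ∘ (mu† ⊗ id A);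
  mu_special : mu ∘ mu† = id A
}.

Definition delta (C : strict_sym_monoidal_dagger_category) (A : ob C)
    (F : dagger_SCFA A) : hom A (A ⊠ A) := (mu F)†.

Definition eps (C : strict_sym_monoidal_dagger_category) (A : ob C)
    (F : dagger_SCFA A) : hom A unit := (eta F)†.

(* The bialgebra laws with the scalar [s] restored.  In Hilbert spaces, let D
   be the dimension and let green copy an orthonormal basis indexed by an
   abelian group.  Red being special forces mu_r |i,j> = |i+j> / sqrt D and
   eta_r = sqrt D |0>, and the laws hold exactly with s = eps_g eta_r = sqrt D.
   The laws for s = id would force D <= 1.  They are a special case: they give
   s • eta_r = eta_r for s = eps_g eta_r, hence s • id_A = id_A, so the laws
   also hold with this s. *)
Record bialgebra (C : strict_sym_monoidal_dagger_category) (A : ob C)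
    (G R : dagger_SCFA A) (s : hom (@unit C) unit) : Prop := {
  bialgebra_mu : delta G ∘ mu R
    = s • ((mu R ⊗ mu R) ∘ middle_swap A A A A ∘ (delta G ⊗ delta G));
  bialgebra_eta : s • (delta G ∘ eta R)
    = (eta R ⊗ eta R) ∘ uncast (tens1o unit);
  bialgebra_eps : s • (eps G ∘ mu R)
    = cast (tens1o unit) ∘ (eps G ⊗ eps G)
}.

Record IF_structure (C : strict_sym_monoidal_dagger_category) (A : ob C) := {
  green : dagger_SCFA A;
  red : dagger_SCFA A;
  IF_bialgebra : bialgebra green red (eps green ∘ eta red);
  IF_eta : eta red
    = cast (tens1o A) ∘ (eps red ⊗ id A) ∘ delta green ∘ eta green;
  IF_eps : eps green
    = eps red ∘ mu red ∘ (id A ⊗ eta green) ∘ uncast (tenso1 A)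
}.

Definition green_phase (C : strict_sym_monoidal_dagger_category) (A : ob C)
    (S : IF_structure A) (a : hom A A) : Prop :=
  unitary a /\ mu (green S) ∘ (a ⊗ id A) = a ∘ mu (green S).

(* The scalar is the one in [bialgebra_eta], so that eta_r is set-like; in the
   Hilbert space example the nonzero set-like points are the sqrt D |i>, whose
   red multiplication maps |j> |-> |i+j> are unitary (with s = id they would be
   the |i>, whose red multiplication maps are not unitary unless D = 1). *)
Definition set_like (C : strict_sym_monoidal_dagger_category) (A : ob C)
    (G : dagger_SCFA A) (s : hom (@unit C) unit) (psi : hom unit A) : Prop :=
  s • (delta G ∘ psi) = (psi ⊗ psi) ∘ uncast (tens1o unit).

Definition green_set_like (C : strict_sym_monoidal_dagger_category)
    (A : ob C) (S : IF_structure A) (psi : hom unit A) : Prop :=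
  set_like (green S) (eps (green S) ∘ eta (red S)) psi.

Definition green_classical (C : strict_sym_monoidal_dagger_category)
    (A : ob C) (S : IF_structure A) (k : hom A A) : Prop :=
  (exists psi : hom unit A, green_set_like S psi
     /\ k = mu (red S) ∘ (psi ⊗ id A) ∘ uncast (tens1o A))
  /\ unitary k.

(* Main.v *)
(** A green-classical map [k] copies through green: [delta_g k = (k ⊗ k) delta_g].
    Indeed [delta_g] passes through [mu_r] by the bialgebra law, and then copies
    the set-like point; the scalar of the bialgebra law is the one absorbed by
    set-likeness.  As [k] is unitary, the dagger of this equation says that [k]
    is a homomorphism for [mu_g], and conjugating by an automorphism of the
    green multiplication preserves green phases. *)

From Corelib Require Import ssreflect.
From Stdlib Require Import ProofIrrelevance.
Require Import Defs.
Local Open Scope smdc_scope.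

Section StrictMonoidal.

Context {C : strict_sym_monoidal_dagger_category}.
Implicit Types A B D E : ob C.

(* The strictness equations come without coherence, so that pasting them
   needs uniqueness of identity proofs on objects. *)
Lemma cast_irrelevance A B (e e' : A = B) : cast e = cast e'.
Proof. by rewrite (proof_irrelevance _ e e'). Qed.

Lemma cast_id A (e : A = A) : cast e = id A.
Proof. exact: (cast_irrelevance _ _ e eq_refl). Qed.

Lemma cast_comp A B D (e : A = B) (e' : B = D) :
  cast e' ∘ cast e = cast (eq_trans e e').
Proof. by destruct e'; apply: comp_idl. Qed.

Lemma cast_tensm A A' B B' (e : A = A') (e' : B = B') :
  cast e ⊗ cast e' = cast (f_equal2 tens e e').
Proof. by destruct e, e'; rewrite tensm_id cast_id. Qed.

Lemma cast_tensm_id A A' B (e : A = A') :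
  cast e ⊗ id B = cast (f_equal2 tens e (eq_refl B)).
Proof. exact: (cast_tensm _ _ _ _ e (eq_refl B)). Qed.

Lemma id_tensm_cast A B B' (e : B = B') :
  id A ⊗ cast e = cast (f_equal2 tens (eq_refl A) e).
Proof. exact: (cast_tensm _ _ _ _ (eq_refl A) e). Qed.

Lemma castK A B (e : A = B) : uncast e ∘ cast e = id A.
Proof. by rewrite cast_comp cast_id. Qed.

Lemma castKV A B (e : A = B) : cast e ∘ uncast e = id B.
Proof. by rewrite cast_comp cast_id. Qed.

(** The strictness equations are given for forward casts; composing with the inverse casts on both
    sides transfers them to [uncast]. *)
Lemma uncast_nat A A' B B' (e : A = A') (e' : B = B')
    (f : hom A B) (f' : hom A' B') :
  cast e' ∘ f = f' ∘ cast e -> f ∘ uncast e = uncast e' ∘ f'.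
Proof.
move=> H; rewrite -(comp_idl f) -(castK _ _ e') -(compA (uncast e')) H.
by rewrite -!compA castKV comp_idr.
Qed.

Lemma tens1m_uncast A B (f : hom A B) :
  (id unit ⊗ f) ∘ uncast (tens1o A) = uncast (tens1o B) ∘ f.
Proof. exact/uncast_nat/tens1m. Qed.

Lemma tensmA_uncast A B D A' B' D'
    (f : hom A A') (g : hom B B') (h : hom D D') :
  ((f ⊗ g) ⊗ h) ∘ uncast (tensA A B D)
  = uncast (tensA A' B' D') ∘ (f ⊗ (g ⊗ h)).
Proof. exact/uncast_nat/tensmA. Qed.

Lemma tensmAE A B D A' B' D' (f : hom A A') (g : hom B B') (h : hom D D') :
  (f ⊗ g) ⊗ h
  = uncast (tensA A' B' D') ∘ (f ⊗ (g ⊗ h)) ∘ cast (tensA A B D).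
Proof. by rewrite -compA -tensmA compA castK comp_idl. Qed.


Lemma sym_unit_r A :
  sym A unit = cast (eq_trans (tenso1 A) (eq_sym (tens1o A))).
Proof.
by rewrite -cast_comp -sym_unit compA castK comp_idl.
Qed.

(** By [symK] this is the inverse of [sym A unit], which is already a cast. *)
Lemma sym_unit_l A :
  sym unit A = cast (eq_trans (tens1o A) (eq_sym (tenso1 A))).
Proof.
rewrite -(comp_idr (sym unit A)).
rewrite -(castKV _ _ (eq_trans (tenso1 A) (eq_sym (tens1o A)))).
rewrite compA -sym_unit_r symK comp_idl.
exact: cast_irrelevance.
Qed.

Lemma comp_scaler A B D (s : hom unit unit) (f : hom A B) (g : hom B D) :
  g ∘ (s • f) = s • (g ∘ f).
Proof.
by rewrite /scale !compA -tens1m -(compA (cast _)) -tensm_comp comp_idl.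
Qed.

Lemma comp_scalel A B D (s : hom unit unit) (f : hom A B) (g : hom B D) :
  (s • g) ∘ f = s • (g ∘ f).
Proof.
rewrite /scale -!compA -tens1m_uncast; congr (_ ∘ _).
by rewrite compA -tensm_comp comp_idr.
Qed.

(** Scaling is tensoring with [s] on the left, so this is associativity of the tensor; the leftover
    casts have the same endpoints and so agree. *)
Lemma scale_tensml A A' B B' (s : hom unit unit)
    (f : hom A A') (g : hom B B') :
  (s • f) ⊗ g = s • (f ⊗ g).
Proof.
rewrite /scale -{1}(comp_idr g) tensm_comp -{1}(comp_idl g) tensm_comp.
rewrite tensmAE !cast_tensm_id !compA cast_comp -!compA cast_comp !compA.
by congr (_ ∘ _ ∘ _); exact: cast_irrelevance.
Qed.

Lemma middle_swap_nat A B D E A' B' D' E'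
    (f : hom A A') (g : hom B B') (h : hom D D') (k : hom E E') :
  middle_swap A' B' D' E' ∘ ((f ⊗ g) ⊗ (h ⊗ k))
  = ((f ⊗ h) ⊗ (g ⊗ k)) ∘ middle_swap A B D E.
Proof.
rewrite /middle_swap -!compA tensmA !compA tensmA_uncast.
congr (_ ∘ _); rewrite -!compA; congr (_ ∘ _).
rewrite -!tensm_comp comp_idl comp_idr; congr (_ ⊗ _).
rewrite -!compA -tensmA_uncast !compA -tensmA; congr (_ ∘ _).
by rewrite -!compA -!tensm_comp sym_nat comp_idl comp_idr.
Qed.

(** The symmetry involved is [sym unit A], itself a cast, so both sides are casts with the same
    endpoints. *)
Lemma middle_swap_unit A B :
  middle_swap unit unit A B
    ∘ (uncast (tens1o unit) ⊗ id (A ⊠ B)) ∘ uncast (tens1o (A ⊠ B))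
  = uncast (tens1o A) ⊗ uncast (tens1o B).
Proof.
rewrite /middle_swap sym_unit_l cast_tensm !cast_tensm_id !cast_comp.
rewrite id_tensm_cast !cast_comp.
exact: cast_irrelevance.
Qed.

End StrictMonoidal.

Section GreenClassical.

Context {C : strict_sym_monoidal_dagger_category} {A : ob C}.

Lemma set_like_action_copied (G R : dagger_SCFA A) (s : hom unit unit)
    (psi : hom unit A) (k := mu R ∘ (psi ⊗ id A) ∘ uncast (tens1o A)) :
  bialgebra G R s -> set_like G s psi -> delta G ∘ k = (k ⊗ k) ∘ delta G.
Proof.
move=> bi psi_set; rewrite /k.
(* Generalized because rewriting with [compA] would unfold [middle_swap]. *)
move: (middle_swap A A A A) (middle_swap unit unit A A) (bialgebra_mu bi)
  (middle_swap_nat _ _ _ _ _ _ _ _ psi psi (id A) (id A))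
  (middle_swap_unit A A) => swap swap1 delta_mu swap_nat swap_unit.
rewrite 2!compA delta_mu !comp_scalel -!compA.
rewrite (compA _ (psi ⊗ id A)) -tensm_comp comp_idr.
(* The scalar slides inwards until it meets [delta G ∘ psi], where set-likeness absorbs it. *)
rewrite -2!comp_scaler -comp_scalel -scale_tensml psi_set.
(* Splitting off [delta G] leaves [(psi ⊗ psi) ⊗ (id A ⊗ id A)], which the middle swap regroups into
   two copies of [psi ⊗ id A]. *)
rewrite -{1}(comp_idl (delta G)).
have -> : ((psi ⊗ psi) ∘ uncast (tens1o unit)) ⊗ (id _ ∘ delta G)
  = ((psi ⊗ psi) ⊗ (id A ⊗ id A)) ∘ (uncast (tens1o unit) ⊗ id _)
    ∘ (id unit ⊗ delta G).
  by rewrite -!tensm_comp tensm_id !comp_idl comp_idr.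
rewrite -!compA tens1m_uncast !compA -(compA (mu R ⊗ mu R)) swap_nat.
rewrite !tensm_comp -!compA; do 2 congr (_ ∘ _).
by rewrite !compA swap_unit.
Qed.

Lemma mu_unitary_copied (G : dagger_SCFA A) (k : hom A A) :
  unitary k -> delta G ∘ k = (k ⊗ k) ∘ delta G ->
  mu G ∘ (k ⊗ k) = k ∘ mu G.
Proof.
move=> [kK kKV] /(f_equal dag).
rewrite !dag_comp dag_tensm /delta dagK => kmu.
(* With [k ∘ k†] inserted after [mu G], the daggered equation carries [k†] to both inputs, where it
   cancels [k ⊗ k]. *)
rewrite -{1}(comp_idl (mu G)) -kKV -(compA k) kmu -!compA -tensm_comp kK.
by rewrite tensm_id comp_idr.
Qed.

Lemma unitary_comp (u v : hom A A) : unitary u -> unitary v -> unitary (u ∘ v).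
Proof.
move=> [uK uKV] [vK vKV]; split; rewrite dag_comp.
- by rewrite compA -(compA (v†)) uK comp_idr.
- by rewrite compA -(compA u) vKV comp_idr.
Qed.

Lemma unitary_dag (u : hom A A) : unitary u -> unitary (u†).
Proof. by move=> [uK uKV]; split; rewrite dagK. Qed.

End GreenClassical.

Theorem theorem9 (C : strict_sym_monoidal_dagger_category) (A : ob C)
    (S : IF_structure A) (alpha k : hom A A)
    (halpha : green_phase S alpha) (hk : green_classical S k) :
  green_phase S (k ∘ alpha ∘ k†).
Proof.
case: halpha => alphaU alpha_mu; case: hk => -[psi [psi_set kE]] kU.
have k_mu : mu (green S) ∘ (k ⊗ k) = k ∘ mu (green S).
  apply: mu_unitary_copied => //; rewrite kE.
  exact: set_like_action_copied (IF_bialgebra S) psi_set.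
have kV_mu : mu (green S) ∘ (k† ⊗ k†) = k† ∘ mu (green S).
  case: kU => kK kKV; rewrite -(comp_idl (mu _)) -{1}kK -(compA (k†)) -k_mu.
  by rewrite -!compA -tensm_comp kKV tensm_id !comp_idr comp_idl.
split; first exact: unitary_comp (unitary_comp _ _ kU alphaU) (unitary_dag _ kU).
(* Reading the second factor as [k ∘ k†] lets [k] and [k†] act on both inputs, as multiplicativity
   requires. *)
have -> : (k ∘ alpha ∘ k†) ⊗ id A = (k ⊗ k) ∘ (alpha ⊗ id A) ∘ (k† ⊗ k†).
  by rewrite -!tensm_comp comp_idr (proj2 kU).
by rewrite !compA k_mu -(compA k) alpha_mu -!compA kV_mu.
Qed.
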